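(* Let $n\ge 1$, let $H(x,y)=\sum_{k=1}^{n}\sum_{j=0}^{k}a_{k,j}\,x^{k-j}y^{j}$ be a real polynomial of degree $n$, and let $X$ be a nonzero piecewise-smooth vector field on the torus $\mathbb{T}^2$, defined on the fundamental domain $[0,1]^2$ by $$X(x,y)=\begin{cases}X_H(x,y), & (x,y)\in(0,1)^2,\\ X_H(\pi(x,y)), & (x,y)\in\partial[0,1]^2,\end{cases}$$ with polynomial first integral $H$ and with discontinuity region exactly the boundary of the square $\Sigma=\partial[0,1]^2$, where $\pi:\partial[0,1]^2\to[0,1]^2$ is the projection that glues opposite edges. Assume that: 1. $H(0,0)=0$ and $H(x,0)-H(x,1)\not\equiv 0$ (as a polynomial in $x$); 2. for each $\mathbf{bb}$-type cycle $\gamma_{x_0}\subset\{H=H(x_0,0)\}$, $\min_{(x,y)\in\gamma_{x_0}}\|\nabla H(x,y)\|>0$; 3. for each such cycle, $X(x_0,0)\cdot(0,1)\neq 0$ and $X(x_0,1)\cdot(0,-1)\neq 0$. Then $X$ has at most $n-1$ limit cycles of type $\mathbf{bb}$. Analogously for type $\mathbf{aa}$: if $H(0,0)=0$, $H(0,y)-H(1,y)\not\equiv 0$ (as a polynomial in $y$), and every $\mathbf{aa}$-type cycle $\gamma_{y_0}\subset\{H=H(0,y_0)\}$ satisfies $\min_{(x,y)\in\gamma_{y_0}}\|\nabla H(x,y)\|>0$, $X(0,y_0)\cdot(1,0)\neq 0$ and $X(1,y_0)\cdot(-1,0)\neq 0$, then $X$ has at most $n-1$ limit cycles of type $\mathb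f{aa}$.
   Context: The torus $\mathbb{T}^2$ is the quotient of $[0,1]^2$ obtained by identifying opposite edges: $(x,0)\sim(x,1)$ and $(0,y)\sim(1,y)$. The set $\Sigma=\partial[0,1]^2$ is the switching (discontinuity) manifold: a trajectory reaching an edge reappears at the identified point of the opposite edge. $X_H$ denotes the Hamiltonian vector field $X_H=(-\partial_yH,\partial_xH)$, for which $H$ is a first integral (constant along orbits). Trajectories at $\Sigma$ follow Filippov's convention: near a point of $\Sigma$, with $\Sigma$ written locally as $\{h=0\}$ ($\nabla h\ne0$) and $X^{\pm}$ the vector fields on the two sides $\{\pm h>0\}$ (on the torus, the two sides of an edge are neighborhoods of the two identified points of opposite edges), the point lies in the sewing (crossing) region if $\langle X^+,\nabla h\rangle\,\langle X^-,\nabla h\rangle>0$, and trajectories then cross $\Sigma$. A (crossing) limit cycle is a closed orbit of $X$ on $\mathbb{T}^2$ that meets $\Sigma$ transversally at sewing points, and which is the unique closed orbit with this property in some neighborhood of itself. Type $\mathbf{bb}$: the cycle $\gamma_{x_0}$ consists of one trajectory arc of $X_H$ inside the open square joining $(x_0,0)$ to $(x_0,1)$ (in either time direction) for some $x_0\in(0,1)$, closed up by the identification $(x_0,0)\sim(x_0,1)$. Type $\mathbf{aa}$: the cycle $\gamma_{y_0}$ consists of one trajectory arc of $X_H$ inside the open square joining $(0,y_0)$ to $(1,y_0)$ (in either time direction) for some $y_0\in(0,1)$, closed up by $(0,y_0)\sim(1,y_0)$. *)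

(* Defs.v *)
From mathcomp Require Import all_boot all_order all_algebra.
From mathcomp Require Import all_classical all_reals all_analysis.
Set Implicit Arguments.
Unset Strict Implicit.
Unset Printing Implicit Defensive.
Import Order.TTheory GRing.Theory Num.Theory.
Import numFieldNormedType.Exports.
Local Open Scope classical_set_scope.
Local Open Scope ring_scope.

Section Torus.
Variable R : realType.
Implicit Types (p q : R * R) (A U G : set (R * R)).

Definition square : set (R * R) :=
  [set p | (0 <= p.1 <= 1) && (0 <= p.2 <= 1)].

Definition open_square : set (R * R) :=
  [set p | (0 < p.1 < 1) && (0 < p.2 < 1)].

Definition Sigma : set (R * R) := square `\` open_square.

Definition circle_eq (s t : R) : Prop :=
  [\/ s = t, s = 0 /\ t = 1 | s = 1 /\ t = 0].

(* The torus is handled through its fundamental domain: its points are the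
   classes of [torus_eq] on [square] (the four corners form one class), and its
   subsets are the subsets of [square] that are unions of classes. *)
Definition torus_eq p q : Prop := circle_eq p.1 q.1 /\ circle_eq p.2 q.2.

Definition torus_image A : set (R * R) :=
  [set p | square p /\ exists2 q, A q & torus_eq p q].

(* Open sets of the quotient topology. *)
Definition torus_open U : Prop :=
  torus_image U = U /\ exists2 V, open V & U = square `&` V.

Definition dot p q : R := p.1 * q.1 + p.2 * q.2.

(* [X] may take different values at identified points of [Sigma]; continuity
   then includes that these values coincide. *)
Definition torus_continuous_at (X : R * R -> R * R) p : Prop :=
  exists v, forall e : R, 0 < e ->
    exists U, [/\ torus_open U, U p & forall q, U q -> `|X q - v| < e].

(* Closure of the set of discontinuity points: the fields on the two sides of an
   edge are allowed to agree at isolated points. *)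
Definition discontinuity_region (X : R * R -> R * R) : set (R * R) :=
  [set p | square p /\ forall U, torus_open U -> U p ->
     exists2 q, U q & ~ torus_continuous_at X q].

(* A boundary point is sent to some point it is identified with. No particular
   representative is imposed: [prj] may be constant on classes (a single-valued
   field on the torus) or be the identity (one-sided values at each edge). *)
Definition edge_projection (prj : R * R -> R * R) : Prop :=
  forall p, Sigma p -> square (prj p) /\ torus_eq (prj p) p.

Definition torus_field (prj F : R * R -> R * R) (p : R * R) : R * R :=
  if p \in open_square then F p else F (prj p).

(* In {poly {poly R}} the outer variable 'X is x and the inner one 'Y is y. *)
Definition bipoly (n : nat) (a : nat -> nat -> R) : {poly {poly R}} :=
  \sum_(1 <= k < n.+1) \sum_(0 <= j < k.+1)
     (a k j)%:P%:P * 'X^(k - j) * 'Y ^+ j.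

Implicit Type H : {poly {poly R}}.

Definition heval H p : R := H.[p.1, p.2].

Definition grad H p : R * R :=
  (heval H^`() p, heval (map_poly (@deriv R) H) p).

Definition hamiltonian H p : R * R := (- (grad H p).2, (grad H p).1).

Definition enorm p : R := Num.sqrt (dot p p).

Definition arc H (T : R) (c : R -> R * R) : Prop :=
  [/\ 0 < T, {within `[0, T], continuous c} &
      forall t, 0 < t < T ->
        open_square (c t) /\ is_derive t (1 : R) c (hamiltonian H (c t))].

Definition support (T : R) (c : R -> R * R) : set (R * R) := c @` `[0, T].

(* Around a horizontal edge h = y: the side h > 0 is a neighbourhood of (x, 0),
   the side h < 0 one of (x, 1); similarly for a vertical edge with h = x.
   At the corners [Sigma] is not a level set of a submersion. *)
Definition sewing H p : Prop :=
  (exists x, [/\ 0 < x < 1, torus_eq p (x, 0) &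
     0 < dot (hamiltonian H (x, 0)) (0, 1) * dot (hamiltonian H (x, 1)) (0, 1)])
  \/
  (exists y, [/\ 0 < y < 1, torus_eq p (0, y) &
     0 < dot (hamiltonian H (0, y)) (1, 0) * dot (hamiltonian H (1, y)) (1, 0)]).

(* A positive number of arcs, each run forward in time; the end of each one is
   sewn to the start of the (cyclically) next, so all endpoints lie on [Sigma]. *)
Definition crossing_closed_orbit H G : Prop :=
  exists m (T : 'I_m.+1 -> R) (c : 'I_m.+1 -> R -> R * R),
    [/\ forall i, arc H (T i) (c i),
        forall i, sewing H (c i (T i)) /\
                  torus_eq (c i (T i)) (c (ordS i) 0) &
        G = torus_image (\bigcup_i support (T i) (c i))].

Definition limit_cycle H G : Prop :=
  crossing_closed_orbit H G /\
  exists U, [/\ torus_open U, G `<=` U &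
    forall G', crossing_closed_orbit H G' -> G' `<=` U -> G' = G].

Definition joining_cycle H p q G : Prop :=
  exists T c, [/\ arc H T c,
    (c 0 = p /\ c T = q) \/ (c 0 = q /\ c T = p) &
    G = torus_image (support T c)].

Definition bb_cycle H (x0 : R) G : Prop :=
  0 < x0 < 1 /\ joining_cycle H (x0, 0) (x0, 1) G.

Definition aa_cycle H (y0 : R) G : Prop :=
  0 < y0 < 1 /\ joining_cycle H (0, y0) (1, y0) G.

Definition positive_min (f : R * R -> R) G : Prop :=
  exists p, [/\ G p, forall q, G q -> f p <= f q & 0 < f p].

End Torus.

(* Main.v *)
(** A type bb cycle is an orbit arc of X_H joining (x, 0) to (x, 1), so H takes
    the same value at both ends and x is a root of H(x, 0) - H(x, 1).  The
    monomial x^n cancels in this difference, which leaves at most n - 1 roots.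
    Conversely x determines the cycle: two arcs run in the same direction
    coincide by uniqueness for the polynomial (hence Lipschitz on the square)
    field X_H, and arcs run in opposite directions would force the component
    of X_H normal to the edge to vanish at both ends, against transversality.
    Type aa is the same with the coordinates exchanged. *)
Require Import Defs.
From mathcomp Require Import all_boot all_order all_algebra.
From mathcomp Require Import all_classical all_reals all_analysis.
From mathcomp Require Import lra ring.
From mathcomp Require polyrcf.
Set Implicit Arguments.
Unset Strict Implicit.
Unset Printing Implicit Defensive.
Import Order.TTheory GRing.Theory Num.Theory.
Import numFieldNormedType.Exports.
Local Open Scope classical_set_scope.
Local Open Scope ring_scope.

(** * Polynomials in two variables: derivatives along curves, Lipschitz bounds on the square *)

Section PlanarPolynomials.
Variable R : realType.
Implicit Types (G : {poly {poly R}}) (p q : R * R) (f g : R * R -> R).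

Lemma heval_cons G (r : {poly R}) p :
  heval (G * 'X + r%:P) p = heval G p * p.1 + r.[p.2].
Proof. by rewrite /heval !hornerE. Qed.

(** The Leibniz rule for one Horner step in x, on which the induction for [is_derive_heval]
    rests. *)
Lemma grad_cons G (r : {poly R}) p :
  grad (G * 'X + r%:P) p =
  ((grad G p).1 * p.1 + heval G p, (grad G p).2 * p.1 + r^`().[p.2]).
Proof.
rewrite /grad -(heval_cons _ r^`()); congr pair; last congr heval.
  by rewrite /heval derivD derivM derivX derivC addr0 mulr1 !hornerE.
apply/polyP => i; rewrite !(coef_map, coefD, coefMX, coefC) /=.
by case: i => [|i] /=; rewrite !(add0r, addr0, raddf0, raddfD).
Qed.

Lemma is_derive_fst (c : R -> R * R) (t : R) v :
  is_derive t 1 c v -> is_derive t 1 (fst \o c) v.1.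
Proof.
case=> dc <-.
have h : (fun h => h^-1 *: (((fst \o c) \o shift t) (h *: 1) - (fst \o c) t)) @ 0^'
    --> ('D_1 c t).1.
  apply: (cvg_comp _ fst dc).
  exact: cvg_fst.
split; last exact: cvg_lim h.
by apply/cvg_ex; exists ('D_1 c t).1.
Qed.

Lemma is_derive_snd (c : R -> R * R) (t : R) v :
  is_derive t 1 c v -> is_derive t 1 (snd \o c) v.2.
Proof.
case=> dc <-.
have h : (fun h => h^-1 *: (((snd \o c) \o shift t) (h *: 1) - (snd \o c) t)) @ 0^'
    --> ('D_1 c t).2.
  apply: (cvg_comp _ snd dc).
  exact: cvg_snd.
split; last exact: cvg_lim h.
by apply/cvg_ex; exists ('D_1 c t).2.
Qed.

Lemma is_derive_dot (c : R -> R * R) (t k : R) v w : is_derive t 1 c v ->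
  is_derive t 1 (fun s => k + dot (c s) w) (dot v w).
Proof.
move=> dc; have dx := is_derive_fst dc; have dy := is_derive_snd dc.
have D := is_deriveD (is_derive_cst k t 1)
  (is_deriveD (is_deriveM dx (is_derive_cst w.1 t 1))
              (is_deriveM dy (is_derive_cst w.2 t 1))).
by apply: (is_derive_eq D); rewrite /dot /GRing.scale /=; ring.
Qed.

Lemma is_derive_sum_sqr (u v : R -> R) (t du dv : R) :
  is_derive t 1 u du -> is_derive t 1 v dv ->
  is_derive t 1 (fun s => u s * u s + v s * v s) (2 * (u t * du + v t * dv)).
Proof.
move=> Du Dv; have D := is_deriveD (is_deriveM Du Du) (is_deriveM Dv Dv).
by apply: (is_derive_eq D); rewrite /GRing.scale /=; ring.
Qed.

(** The chain rule, by induction on the Horner form in x: each step adds a product with the first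
    coordinate and a univariate polynomial of the second. *)
Lemma is_derive_heval G (c : R -> R * R) (t : R) v : is_derive t 1 c v ->
  is_derive t 1 (heval G \o c) (dot (grad G (c t)) v).
Proof.
move=> dc; have dx := is_derive_fst dc; have dy := is_derive_snd dc.
elim/poly_ind: G => [|G r IH].
  have -> : heval (0 : {poly {poly R}}) \o c = cst 0.
    by apply/funext => s /=; rewrite /heval !hornerE.
  apply: is_derive_eq; rewrite /dot /grad /heval deriv0 map_poly0 /= !horner0.
  by rewrite !mul0r addr0.
have -> : heval (G * 'X + r%:P) \o c =
    (heval G \o c) * (fst \o c) + (horner r \o (snd \o c)).
  by apply/funext => s; exact: heval_cons.
apply: is_derive_eq; rewrite grad_cons /dot /GRing.scale /=; ring.
Qed.

Lemma continuous_heval G : continuous (heval G).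
Proof.
elim/poly_ind: G => [|G r IH] p.
  rewrite (_ : heval _ = cst 0); first exact: cvg_cst.
  by apply/funext => s /=; rewrite /heval !hornerE.
rewrite (_ : heval _ = fun q => heval G q * q.1 + r.[q.2]); last first.
  by apply/funext => s /=; rewrite heval_cons.
apply: cvgD; first by apply: cvgM; [exact: IH | exact: cvg_fst].
by apply: (@cvg_comp _ _ _ snd (horner r)); [exact: cvg_snd | exact: continuous_horner].
Qed.

(** The l1 distance gives both coordinate projections the constant 1. Boundedness of the square is
    what makes this class stable under products. *)
Definition lipschitz_square f : Prop := exists L, forall p q,
  square p -> square q -> `|f p - f q| <= L * (`|p.1 - q.1| + `|p.2 - q.2|).

Lemma lipschitz_squareD f g : lipschitz_square f -> lipschitz_square g ->
  lipschitz_square (fun p => f p + g p).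
Proof.
move=> [L fL] [M gM]; exists (L + M) => p q sp sq.
rewrite opprD addrACA mulrDl (le_trans (ler_normD _ _))// lerD//.
  exact: fL.
exact: gM.
Qed.

Lemma lipschitz_square_bounded f : lipschitz_square f ->
  exists B, forall p, square p -> `|f p| <= B.
Proof.
(* The 2 bounds the l1 distance from a point of the square to the corner (0, 0). *)
move=> [L fL]; exists (`|f (0, 0)| + `|L| * 2) => p sp.
have s0 : square (0 : R, 0 : R) by rewrite /square /= !lexx ler01.
rewrite (_ : f p = f (0, 0) + (f p - f (0, 0))); last by ring.
rewrite (le_trans (ler_normD _ _))// lerD2l (le_trans (fL _ _ sp s0))//= !subr0.
have /andP[/andP[x0 x1] /andP[y0 y1]] := sp.
rewrite (le_trans (ler_wpM2r _ (ler_norm L))) ?addr_ge0//.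
by rewrite ler_wpM2l// !ger0_norm//; lra.
Qed.

Lemma lipschitz_squareM f g : lipschitz_square f -> lipschitz_square g ->
  lipschitz_square (fun p => f p * g p).
Proof.
move=> lf lg; have [A fA] := lipschitz_square_bounded lf.
have [B gB] := lipschitz_square_bounded lg; have [L fL] := lf; have [M gM] := lg.
exists (A * M + B * L) => p q sp sq.
rewrite (_ : _ - _ = f p * (g p - g q) + g q * (f p - f q)); last by ring.
rewrite mulrDl (le_trans (ler_normD _ _))// !normrM -!mulrA.
by rewrite lerD// ler_pM// ?fA ?gB ?fL ?gM.
Qed.

Lemma lipschitz_square_cst (k : R) : lipschitz_square (fun=> k).
Proof. by exists 0 => p q _ _; rewrite subrr normr0 mul0r. Qed.

Lemma lipschitz_square_fst : lipschitz_square fst.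
Proof. by exists 1 => p q _ _; rewrite mul1r lerDl. Qed.

Lemma lipschitz_square_snd : lipschitz_square snd.
Proof. by exists 1 => p q _ _; rewrite mul1r lerDr. Qed.

(** Two Horner inductions, first in x, then in y on the coefficient [r]. *)
Lemma lipschitz_square_heval G : lipschitz_square (heval G).
Proof.
elim/poly_ind: G => [|G r IH].
  rewrite (_ : heval _ = fun=> 0); first exact: lipschitz_square_cst.
  by apply/funext => s /=; rewrite /heval !hornerE.
rewrite (_ : heval _ = fun q => heval G q * q.1 + r.[q.2]); last first.
  by apply/funext => s /=; rewrite heval_cons.
apply: lipschitz_squareD.
  by apply: lipschitz_squareM => //; exact: lipschitz_square_fst.
elim/poly_ind: r {G IH} => [|r k IH].
  rewrite (_ : (fun _ => _) = fun=> 0); first exact: lipschitz_square_cst.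
  by apply/funext => s /=; rewrite hornerE.
rewrite (_ : (fun _ => _) = fun q => r.[q.2] * q.2 + k); last first.
  by apply/funext => s /=; rewrite !hornerE.
apply: lipschitz_squareD; last exact: lipschitz_square_cst.
by apply: lipschitz_squareM => //; exact: lipschitz_square_snd.
Qed.

End PlanarPolynomials.

(** * Arcs of X_H: conservation of H, uniqueness, direction at the endpoints *)

Section Arcs.
Variable R : realType.
Implicit Types (H : {poly {poly R}}) (p q w : R * R) (T t : R).

(** Multiplying [D] by exp(-K t) turns the differential inequality into a nonpositive derivative.
    Differentiability is asked at interior times only, which is what an arc provides. *)
Lemma gronwall_le0 (K T : R) (D dD : R -> R) :
  {within `[0, T], continuous D} ->
  (forall t, 0 < t < T -> is_derive t (1 : R) D (dD t)) ->
  (forall t, 0 < t < T -> dD t <= K * D t) ->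
  D 0 <= 0 -> forall t, 0 <= t <= T -> D t <= 0.
Proof.
move=> Dcont Dder dDle D0 t /andP[]; rewrite le_eqVlt => /predU1P[<-//|t0 tT].
pose e s := expR (- K * s).
have eder s : is_derive s (1 : R) e (- K * e s).
  apply: (@is_derive_eq _ _ _ _ _ _ _ (e s * - K)); last by rewrite mulrC.
  apply: (@is_derive1_comp _ expR (fun s => - K * s)).
  rewrite (_ : (fun _ => _) = ( - K) \*: id) //.
  by apply: is_derive_eq; rewrite /GRing.scale /= mulr1.
have sT s : s \in `]0, t[ -> 0 < s < T.
  by rewrite in_itv /= => /andP[-> /lt_le_trans ->].
have [s /sT s0T] : exists2 s, s \in `]0, t[ &
    D t * e t - D 0 * e 0 = e s * (dD s - K * D s) * (t - 0).
  apply: (@MVT _ (fun s => D s * e s)) => //.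
    move=> s /sT /Dder Ds; rewrite (_ : (fun _ => _) = D * e)//.
    by apply: is_derive_eq; rewrite /GRing.scale /=; ring.
  apply: (@continuous_subspaceW _ _ _ `[0, T]).
    by apply: subset_itvl; rewrite bnd_simp.
  move=> s; apply: cvgM; first exact: Dcont.
  apply: continuous_subspaceT => x.
  exact/differentiable_continuous/derivable1_diffP.
rewrite subr0 => /eqP; rewrite subr_eq => /eqP DE.
have eE x : 0 < e x by exact: expR_gt0.
rewrite -(pmulr_lle0 _ (eE t)) DE -[leRHS](addr0 0) lerD//; last by rewrite pmulr_lle0.
by rewrite pmulr_lle0// pmulr_rle0// subr_le0 dDle.
Qed.

Lemma arc_comp_continuous H T c (f : R * R -> R) : Defs.arc H T c ->
  continuous f -> {within `[0, T], continuous (f \o c)}.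
Proof.
move=> [_ cc _] fc t.
by apply: (@continuous_comp (subspace `[0, T]) _ _ c f); [exact: (cc t) | exact: fc].
Qed.

Lemma fst_continuous : continuous (@fst R R).
Proof. by move=> p; exact: cvg_fst. Qed.

Lemma snd_continuous : continuous (@snd R R).
Proof. by move=> p; exact: cvg_snd. Qed.

(** X_H is orthogonal to the gradient of H; continuity on the closed interval carries the
    conservation to both endpoints. *)
Lemma arc_conserved H T c t : Defs.arc H T c -> 0 <= t <= T ->
  heval H (c t) = heval H (c 0).
Proof.
move=> ac /andP[t0 tT]; have [_ _ dc] := ac.
apply/eqP; rewrite -subr_eq0; apply/eqP.
have [||s _ ->] := @MVT_segment R (heval H \o c) (fun=> 0) 0 t t0; last exact: mul0r.
  move=> s; rewrite in_itv /= => /andP[s0 st].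
  have [|_ dcs] := dc s; first by rewrite s0 (lt_le_trans st).
  apply: is_derive_eq; first exact: is_derive_heval.
  by rewrite /hamiltonian /dot /=; ring.
apply: (@continuous_subspaceW _ _ _ `[0, T]).
  by apply: subset_itvl; rewrite bnd_simp.
exact: (arc_comp_continuous ac (@continuous_heval _ H)).
Qed.

Lemma open_square_square : @open_square R `<=` @square R.
Proof.
move=> p /andP[/andP[? ?] /andP[? ?]].
by apply/andP; split; apply/andP; split; apply: ltW.
Qed.

(** Gronwall for the squared distance between the arcs; both stay in the square at interior times,
    where the field is Lipschitz. *)
Lemma arc_unique H T T' c c' : Defs.arc H T c -> Defs.arc H T' c' -> T <= T' ->
  c 0 = c' 0 -> forall t, 0 <= t <= T -> c t = c' t.
Proof.
move=> ac ac' TT' c0 t tT; have [_ cc dc] := ac; have [_ cc' dc'] := ac'.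
have [Lx lipx] := lipschitz_square_heval H^`().
have [Ly lipy] := lipschitz_square_heval (map_poly (@deriv R) H).
pose u s := (c s).1 - (c' s).1; pose v s := (c s).2 - (c' s).2.
pose du s := (hamiltonian H (c s)).1 - (hamiltonian H (c' s)).1.
pose dv s := (hamiltonian H (c s)).2 - (hamiltonian H (c' s)).2.
have diff_cont (f : R * R -> R) : continuous f ->
    {within `[0, T], continuous (fun s => f (c s) - f (c' s))}.
  move=> fc; have cf := arc_comp_continuous ac fc.
  have cf' : {within `[0, T], continuous (f \o c')}.
    apply: (@continuous_subspaceW _ _ _ `[0, T']).
      by apply: subset_itvl; rewrite bnd_simp.
    exact: (arc_comp_continuous ac' fc).
  by move=> s; apply: (cvgB (cf s) (cf' s)).
have uc : {within `[0, T], continuous u} by exact: diff_cont fst_continuous.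
have vc : {within `[0, T], continuous v} by exact: diff_cont snd_continuous.
have der s : 0 < s < T -> is_derive s (1 : R) u (du s) /\ is_derive s (1 : R) v (dv s).
  move=> sT; have [_ ds] := dc _ sT.
  have [|_ ds'] := dc' s.
    by case/andP: sT => -> /lt_le_trans ->.
  split; [have A := is_derive_fst ds; have B := is_derive_fst ds' |
          have A := is_derive_snd ds; have B := is_derive_snd ds'].
    exact: (is_deriveB A B).
  exact: (is_deriveB A B).
(* Absolute values, since [Lx] and [Ly] come without a sign: [L] dominates both and is
   nonnegative. *)
pose L := `|Lx| + `|Ly|.
have bound s : 0 < s < T ->
    `|du s| <= L * (`|u s| + `|v s|) /\ `|dv s| <= L * (`|u s| + `|v s|).
  move=> sT; have [/open_square_square cs _] := dc _ sT.
  have [|/open_square_square cs' _] := dc' s.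
    by case/andP: sT => -> /lt_le_trans ->.
  split.
    rewrite /du /= -opprD normrN (le_trans (lipy _ _ cs cs'))//.
    by rewrite ler_wpM2r ?addr_ge0// (le_trans (ler_norm _)) // lerDr.
  rewrite (le_trans (lipx _ _ cs cs'))//.
  by rewrite ler_wpM2r ?addr_ge0// (le_trans (ler_norm _)) // lerDl.
suff : u t * u t + v t * v t <= 0.
  move=> h; have [u0 v0] : u t = 0 /\ v t = 0.
    split; nra.
  by rewrite [c t]surjective_pairing [c' t]surjective_pairing; congr pair;
    apply/eqP; rewrite -subr_eq0; apply/eqP.
pose D s := u s * u s + v s * v s.
(* In 4 L, one factor 2 comes from differentiating squares, the other from (|u| + |v|)^2 <= 2 (u^2 +
   v^2). *)
apply: (@gronwall_le0 (4 * L) T D (fun s => 2 * (u s * du s + v s * dv s))) => //.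
- by move=> s; apply: cvgD; apply: cvgM; [exact: uc|exact: uc|exact: vc|exact: vc].
- move=> s sT; have [? ?] := der s sT.
  exact: is_derive_sum_sqr.
- move=> s sT; have [dus dvs] := bound s sT.
  have hu : u s * du s <= `|u s| * (L * (`|u s| + `|v s|)).
    by rewrite (le_trans (ler_norm _))// normrM ler_wpM2l.
  have hv : v s * dv s <= `|v s| * (L * (`|u s| + `|v s|)).
    by rewrite (le_trans (ler_norm _))// normrM ler_wpM2l.
  have L0 : 0 <= L by rewrite addr_ge0.
  have uu : u s * u s = `|u s| * `|u s| by rewrite -!expr2 real_normK// num_real.
  have vv : v s * v s = `|v s| * `|v s| by rewrite -!expr2 real_normK// num_real.
  rewrite /D uu vv.
  have := mulr_ge0 L0 (sqr_ge0 (`|u s| - `|v s|)).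
  nra.
- by rewrite /D /u /v c0 !subrr !mul0r addr0.
Qed.

Lemma within_continuous_near_lt0 T (f : R -> R) e : {within `[0, T], continuous f} ->
  0 <= e <= T -> f e < 0 ->
  exists2 d, 0 < d & forall s, 0 <= s <= T -> `|e - s| < d -> f s < 0.
Proof.
move=> fc eT fe.
have eI : [set` `[0, T]] e by rewrite /= in_itv.
have := fc e; rewrite /continuous_at /= => /cvgr_lt /(_ _ fe).
rewrite /prop_near1 /nbhs /= -nbhs_subspace_in// =>  -[d /= d0 de].
by exists d => // s sT /de; apply; rewrite /= in_itv.
Qed.

(** The expression [k + dot (c t) w] stands for the height of [c t] above the line of an edge with
    inward normal [w]. *)
Lemma arc_dot_continuous H T c k w : Defs.arc H T c ->
  {within `[0, T], continuous (fun t => k + dot (c t) w)}.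
Proof.
move=> ac t; apply: cvgD; first exact: cvg_cst.
by apply: cvgD; (apply: cvgM; last exact: cvg_cst);
 [exact: (arc_comp_continuous ac fst_continuous)|
  exact: (arc_comp_continuous ac snd_continuous)].
Qed.

Lemma arc_velocity_continuous H T c w : Defs.arc H T c ->
  {within `[0, T], continuous (fun t => dot (hamiltonian H (c t)) w)}.
Proof.
move=> ac t.
apply: cvgD; (apply: cvgM; last exact: cvg_cst).
  by apply: cvgN; exact: (arc_comp_continuous ac (@continuous_heval _ _)).
exact: (arc_comp_continuous ac (@continuous_heval _ _)).
Qed.

Lemma arc_dot_mvt H T c k w a b : Defs.arc H T c -> 0 <= a -> a < b -> b <= T ->
  exists2 s, a < s < b &
    (k + dot (c b) w) - (k + dot (c a) w) = dot (hamiltonian H (c s)) w * (b - a).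
Proof.
move=> ac a0 ab bT; have [_ _ dc] := ac.
have [||s sab E] := @MVT R (fun t => k + dot (c t) w)
  (fun t => dot (hamiltonian H (c t)) w) a b ab.
- move=> s; rewrite in_itv /= => /andP[sa sb].
  have [|_ ds] := dc s; first by rewrite (le_lt_trans a0 sa) (lt_le_trans sb).
  exact: is_derive_dot.
- apply: (@continuous_subspaceW _ _ _ `[0, T]).
    by apply: subset_itv; rewrite bnd_simp.
  exact: arc_dot_continuous ac.
by exists s => //; move: sab; rewrite in_itv.
Qed.

(** A negative normal velocity at time 0 would persist for a short while and, by the mean value
    theorem, push the arc out of the half-plane containing the open square. *)
Lemma arc_start_inward H T c k w : Defs.arc H T c ->
  (forall p, open_square p -> 0 <= k + dot p w) -> k + dot (c 0) w = 0 ->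
  0 <= dot (hamiltonian H (c 0)) w.
Proof.
move=> ac in_half at0; have [T0 _ dc] := ac; rewrite leNgt; apply/negP => v0.
have [|d d0 neg] := within_continuous_near_lt0 (@arc_velocity_continuous H T c w ac) _ v0.
  by rewrite lexx ltW.
(* Halving puts [b] strictly below [d] and [T]: the velocity is negative up to time [b], and [c b]
   is still in the open square. *)
pose b := Num.min d T / 2.
have b0 : 0 < b by rewrite divr_gt0// lt_min d0.
have bm : b < Num.min d T.
  by rewrite ltr_pdivrMr// ltr_pMr ?ltr1n// lt_min d0.
have [bd bT] : b < d /\ b < T by move: bm; rewrite lt_min => /andP[].
have [s /andP[s0 sb]] := @arc_dot_mvt H T c k w 0 b ac (lexx 0) b0 (ltW bT).
rewrite at0 !subr0 => E.
have [|ob _] := dc b; first by rewrite b0.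
have := in_half _ ob; rewrite E leNgt pmulr_llt0// neg//.
  by rewrite ltW//= ltW// (lt_trans sb).
by rewrite sub0r normrN gtr0_norm// (lt_trans sb).
Qed.

(** The mirror argument in time: a positive normal velocity at [T] would place [c (T - b)] outside
    the half-plane. *)
Lemma arc_end_outward H T c k w : Defs.arc H T c ->
  (forall p, open_square p -> 0 <= k + dot p w) -> k + dot (c T) w = 0 ->
  dot (hamiltonian H (c T)) w <= 0.
Proof.
move=> ac in_half atT; have [T0 _ dc] := ac; rewrite leNgt; apply/negP => v0.
have [|||d d0 neg] := @within_continuous_near_lt0 T
    (fun t => - dot (hamiltonian H (c t)) w) T.
- by move=> s; apply: cvgN; exact: (@arc_velocity_continuous H T c w ac).
- by rewrite lexx ltW.
- by rewrite oppr_lt0.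
pose b := Num.min d T / 2.
have b0 : 0 < b by rewrite divr_gt0// lt_min d0.
have bm : b < Num.min d T.
  by rewrite ltr_pdivrMr// ltr_pMr ?ltr1n// lt_min d0.
have [bd bT] : b < d /\ b < T by move: bm; rewrite lt_min => /andP[].
have [||s /andP[s0 sb]] := @arc_dot_mvt H T c k w (T - b) T ac _ _ (lexx T).
- by rewrite subr_ge0 ltW.
- by rewrite gtrBl.
rewrite atT sub0r subKr => E.
have [|ob _] := dc (T - b); first by rewrite subr_gt0 bT gtrBl.
have := in_half _ ob; rewrite -oppr_le0 E leNgt pmulr_lgt0// -oppr_lt0 neg//.
  by rewrite ltW//= ?(lt_trans _ s0)// ?subr_gt0// ltW.
by rewrite gtr0_norm ?subr_gt0// ltrBlDr -ltrBlDl (lt_trans _ s0)// ler_ltB.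
Qed.

End Arcs.

(** * Cycles made of one arc between opposite edges: uniqueness and counting *)

Section JoiningCycles.
Variable R : realType.
Implicit Types (H : {poly {poly R}}) (p q r w : R * R) (G : set (R * R)).

(** If one arc ended strictly earlier, its endpoint would be an interior-time point of the other,
    hence in the open square. So the two durations agree. *)
Lemma arc_support_unique H (T T' : R) c c' :
  Defs.arc H T c -> Defs.arc H T' c' -> c 0 = c' 0 ->
  ~ open_square (c T) -> ~ open_square (c' T') ->
  Defs.support T c = Defs.support T' c'.
Proof.
wlog TT' : T T' c c' / T <= T'.
  move=> wl ac ac' c0 oc oc'; case/orP: (le_total T T') => TT'; first exact: wl.
  by apply/esym; apply: wl.
move=> ac ac' c0 oc _; have cc' := arc_unique ac ac' TT' c0.
have [T0 _ _] := ac; have [_ _ dc'] := ac'.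
have <- : T = T'.
  apply/eqP; rewrite eq_le TT' /= leNgt; apply/negP => ltT.
  apply: oc; rewrite cc' ?lexx ?ltW//.
  by have [|] := dc' T; rewrite ?T0.
by apply: eq_imagel => t /=; rewrite in_itv /= => /cc'.
Qed.

Lemma circle_eq_inner (s t : R) : circle_eq s t -> 0 < t < 1 -> s = t.
Proof.
by move=> [//|[_ te]|[_ te]] /andP[]; rewrite te ltxx.
Qed.

Lemma torus_eq_open r p : open_square p -> torus_eq r p -> r = p.
Proof.
move=> /andP[/andP[x0 x1] /andP[y0 y1]] [].
move=> /circle_eq_inner + /circle_eq_inner; rewrite x0 x1 y0 y1.
move=> /(_ isT) e1 /(_ isT) e2.
by rewrite [r]surjective_pairing e1 e2 -surjective_pairing.
Qed.

(** Both cycle types at once: [p] and [q] stand for identified points of opposite edges, and [w] for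
    the unit normal from the edge of [p] to that of [q]. The hypothesis [glued] excludes corners,
    whose class has four points. *)
Section Strip.
Variables (H : {poly {poly R}}) (prj : R * R -> R * R) (p q w : R * R).
Hypothesis prjP : edge_projection prj.
Hypothesis w_strip : forall r, open_square r -> 0 < dot r w < 1.
Hypotheses (wp : dot p w = 0) (wq : dot q w = 1) (sp : square p).
Hypothesis glued : forall r, torus_eq r p \/ torus_eq r q -> r = p \/ r = q.

Let p_not_open : ~ open_square p.
Proof. by move=> /w_strip; rewrite wp ltxx. Qed.

Let q_not_open : ~ open_square q.
Proof. by move=> /w_strip; rewrite wq ltxx andbF. Qed.

Lemma joining_cycle_level G : joining_cycle H p q G -> heval H q = heval H p.
Proof.
move=> [T [c [ac ends _]]]; have [T0 _ _] := ac.
have := arc_conserved ac (t := T); rewrite lexx ltW// => /(_ isT).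
by case: ends => -[-> ->].
Qed.

(** Closing the support under identification can only add [p] or [q], which lie on the same level.
    This inclusion is a premise of the transversality assumption. *)
Lemma joining_cycle_sub_level G : joining_cycle H p q G ->
  G `<=` [set r | heval H r = heval H p].
Proof.
move=> jG; have qp := joining_cycle_level jG.
have {jG}[T [c [ac ends ->]]] := jG; have [T0 _ dc] := ac.
have c0p : heval H (c 0) = heval H p by case: ends => -[-> _].
move=> r [_ [_ [t /= tT <-] rct]]; move: tT; rewrite in_itv /= => tT.
case: (pselect (open_square (c t))) => [oct|noct].
  by rewrite (torus_eq_open oct rct) (arc_conserved ac tT).
have {tT}[t0|tE] : t = 0 \/ t = T.
  case/andP: tT; rewrite le_eqVlt => /predU1P[<-|t0]; first by left.
  rewrite le_eqVlt => /predU1P[<-|tT]; first by right.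
  by case: noct; have [|] := dc t; rewrite ?t0.
- by case: (@glued r) => [|->|->]//; move: rct; rewrite t0; case: ends => -[-> _]; tauto.
- by case: (@glued r) => [|->|->]//; move: rct; rewrite tE; case: ends => -[_ ->]; tauto.
Qed.

(** The arc from [p] to [q] makes the normal component nonnegative at both points, the arc from [q]
    to [p] makes it nonpositive. *)
Lemma opposite_arcs_tangent (T T' : R) c c' : Defs.arc H T c -> Defs.arc H T' c' ->
  c 0 = p -> c T = q -> c' 0 = q -> c' T' = p ->
  dot (hamiltonian H p) w = 0 /\ dot (hamiltonian H q) w = 0.
Proof.
move=> ac ac' c0 cT c'0 c'T.
have dotN r : dot r (- w) = - dot r w by rewrite /dot /=; ring.
have below r : open_square r -> 0 <= 0 + dot r w.
  by rewrite add0r => /w_strip/andP[/ltW].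
have above r : open_square r -> 0 <= 1 + dot r (- w).
  by rewrite dotN subr_ge0 => /w_strip/andP[_ /ltW].
have := arc_start_inward ac below; have := arc_end_outward ac' below.
have := arc_start_inward ac' above; have := arc_end_outward ac above.
rewrite c0 cT c'0 c'T !dotN wp wq subrr addr0.
move=> /(_ erefl) h1 /(_ erefl) h2 /(_ erefl) h3 /(_ erefl) h4.
by split; lra.
Qed.

Lemma joining_cycle_unique G G' :
  dot (torus_field prj (hamiltonian H) p) w != 0 ->
  joining_cycle H p q G -> joining_cycle H p q G' -> G = G'.
Proof.
(* The field at [p] may be read off at either representative, so tangency is needed at both [p] and
   [q]. *)
have prjE : prj p = p \/ prj p = q.
  by apply: glued; left; have [] := prjP (conj sp p_not_open).
rewrite /torus_field memNset// => tr.
have no_opposite (T T' : R) c c' : Defs.arc H T c -> Defs.arc H T' c' ->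
    c 0 = p -> c T = q -> c' 0 = q -> c' T' = p -> False.
  move=> ac ac' c0 cT c'0 c'T.
  have [hp hq] := opposite_arcs_tangent ac ac' c0 cT c'0 c'T.
  by move: tr; case: prjE => ->; rewrite ?hp ?hq eqxx.
move=> [T [c [ac ends ->]]] [T' [c' [ac' ends' ->]]]; congr torus_image.
case: ends ends' => [[c0 cT] [[c'0 c'T]|[c'0 c'T]]|[c0 cT] [[c'0 c'T]|[c'0 c'T]]].
- by apply: (arc_support_unique ac ac'); rewrite ?c0 ?cT ?c'0 ?c'T.
- by case: (no_opposite _ _ _ _ ac ac').
- by case: (no_opposite _ _ _ _ ac' ac).
- by apply: (arc_support_unique ac ac'); rewrite ?c0 ?cT ?c'0 ?c'T.
Qed.

End Strip.

(** Choosing a root for each element of [A] is injective, and the position of that root in the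
    finite list of roots in (0, 1) numbers the elements. *)
Lemma card_le_roots (U : Type) (A : set U) (P : {poly R}) (f : U -> R -> Prop) n :
  P != 0 -> (size P <= n)%N ->
  (forall u, A u -> exists x, [/\ 0 < x < 1, root P x & f u x]) ->
  (forall x u u', A u -> A u' -> 0 < x < 1 -> f u x -> f u' x -> u = u') ->
  (A #<= `I_(n - 1))%card.
Proof.
move=> P0 Pn ex uni; pose rs := polyrcf.roots P 0 1.
have {}ex u : exists x, A u -> [/\ 0 < x < 1, root P x & f u x].
  (* The value 0 outside [A] only makes the choice function total. *)
  by case: (pselect (A u)) => [/ex[x]|nA]; [exists x | exists 0].
have [g gP] := choice ex.
have g_rs u : A u -> g u \in rs.
  by move=> /gP[x01 rx _]; rewrite polyrcf.in_roots rx P0 in_itv /= x01.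
have szrs : (size rs < n)%N.
  apply: leq_trans Pn; apply: max_poly_roots => //; last exact: polyrcf.uniq_roots.
  by apply/allP => x /polyrcf.root_roots.
apply/pcard_leP/injfunPex; exists (fun u => index (g u) rs).
  move=> u Au /=; rewrite (@leq_trans (size rs))// ?index_mem ?g_rs//.
  by rewrite subn1 -ltnS prednK// (leq_ltn_trans _ szrs).
move=> u u' /set_mem Au /set_mem Au' E.
have Eg : g u = g u' by rewrite -[LHS](nth_index 0 (g_rs _ Au)) E nth_index// g_rs.
have [x01 _ fu] := gP _ Au; have [_ _ fu'] := gP _ Au'.
by apply: (uni (g u)) => //; rewrite Eg.
Qed.

(** The parameter [x] is the position along the edge: conservation of H makes it a root of [P], and
    [joining_cycle_unique] lets it determine the cycle. *)
Lemma card_joining_cycles H prj (p q : R -> R * R) w (P : {poly R}) n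
    (A : set (set (R * R))) :
  edge_projection prj ->
  (forall r, open_square r -> 0 < dot r w < 1) ->
  (forall x, dot (p x) w = 0) -> (forall x, dot (q x) w = 1) ->
  (forall x, 0 < x < 1 -> square (p x)) ->
  (forall x r, 0 < x < 1 -> torus_eq r (p x) \/ torus_eq r (q x) ->
     r = p x \/ r = q x) ->
  P != 0 -> (size P <= n)%N ->
  (forall x, P.[x] = heval H (p x) - heval H (q x)) ->
  (forall x G, 0 < x < 1 -> joining_cycle H (p x) (q x) G ->
     G `<=` [set r | heval H r = heval H (p x)] ->
     dot (torus_field prj (hamiltonian H) (p x)) w != 0) ->
  (forall G, A G -> exists2 x, 0 < x < 1 & joining_cycle H (p x) (q x) G) ->
  (A #<= `I_(n - 1))%card.
Proof.
move=> prjP strip wp wq sp glued P0 Pn PE tr AP.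
apply: (@card_le_roots _ _ P (fun G x => joining_cycle H (p x) (q x) G)) => //.
  move=> G /AP[x x01 jG]; exists x; split => //.
  by rewrite rootE PE (joining_cycle_level jG) subrr.
move=> x G G' _ _ x01 jG jG'.
have gl r := glued x r x01.
apply: (joining_cycle_unique prjP strip (wp x) (wq x) (sp x x01) gl _ jG jG').
apply: (tr x G x01 jG).
exact: (joining_cycle_sub_level gl jG).
Qed.

End JoiningCycles.

(** * Degree of the difference of H between opposite edges *)

Section EdgeDifference.
Variables (R : realType) (n : nat) (a : nat -> nat -> R).

(** A monomial of degree k with j = 0 takes the same value on both edges; the others have degree at
    most k - 1 in x. *)
Lemma size_edge_difference_x :
  (size (map_poly (horner_eval 0) (bipoly n a) -
         map_poly (horner_eval 1) (bipoly n a) : {poly R})%R <= n)%N.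
Proof.
have szD (P Q : {poly R}) : (size P <= n -> size Q <= n -> size (P + Q)%R <= n)%N.
  by move=> Pn Qn; rewrite (leq_trans (size_polyD _ _))// geq_max Pn.
rewrite /bipoly !rmorph_sum -sumrB big_seq.
apply: (big_ind (fun P : {poly R} => size P <= n)%N) => //; first by rewrite size_poly0.
move=> k; rewrite mem_index_iota ltnS => /andP[_ kn].
rewrite !rmorph_sum -sumrB big_seq.
apply: (big_ind (fun P : {poly R} => size P <= n)%N) => //; first by rewrite size_poly0.
move=> j; rewrite mem_index_iota ltnS => jk.
have E (y : R) : map_poly (horner_eval y) ((a k j)%:P%:P * 'X^(k - j) * ('X%:P) ^+ j) =
    (a k j * y ^+ j)%:P * 'X^(k - j).
  rewrite !rmorphM !rmorphXn /= map_polyX !map_polyC /= /horner_eval !hornerE.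
  by rewrite mulrAC.
(* As [0 ^+ 0] is 1, the case j = 0 cancels; for [j.+1] the remaining power of x has size k - j. *)
rewrite /= !E -mulrBl -polyCB -mulrBr; case: j {E} jk => [|j] jk.
  by rewrite !expr0 subrr mulr0 mul0r size_poly0.
rewrite mul_polyC (leq_trans (size_scale_leq _ _))// size_polyXn.
by rewrite (leq_trans _ kn)// -subSn// subSS leq_subr.
Qed.

(** Here the monomials with j = k cancel, and the others leave y^j with j < k. *)
Lemma size_edge_difference_y :
  (size ((bipoly n a).[0%:P] - (bipoly n a).[1%:P])%R <= n)%N.
Proof.
have szD (P Q : {poly R}) : (size P <= n -> size Q <= n -> size (P + Q)%R <= n)%N.
  by move=> Pn Qn; rewrite (leq_trans (size_polyD _ _))// geq_max Pn.
rewrite /bipoly !horner_sum -sumrB big_seq.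
apply: (big_ind (fun P : {poly R} => size P <= n)%N) => //; first by rewrite size_poly0.
move=> k; rewrite mem_index_iota ltnS => /andP[_ kn].
rewrite !horner_sum -sumrB big_seq.
apply: (big_ind (fun P : {poly R} => size P <= n)%N) => //; first by rewrite size_poly0.
move=> j; rewrite mem_index_iota ltnS => /= jk.
have E (x : R) : ((a k j)%:P%:P * 'X^(k - j) * ('X%:P) ^+ j).[x%:P] =
    (a k j * x ^+ (k - j))%:P * 'X^j.
  by rewrite !hornerE polyCM polyC_exp.
rewrite !E -mulrBl -polyCB -mulrBr; case: (ltngtP j k) jk => // [jk _|-> _].
  rewrite mul_polyC (leq_trans (size_scale_leq _ _))// size_polyXn.
  by rewrite (leq_trans jk).
by rewrite subnn !expr0 subrr mulr0 mul0r size_poly0.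
Qed.

End EdgeDifference.
Theorem theorem2 (R : realType) (n : nat) (a : nat -> nat -> R)
    (prj : R * R -> R * R) (H := bipoly n a)
    (X := torus_field prj (hamiltonian H)) :
  (1 <= n)%N ->
  (exists2 j, (j <= n)%N & a n j != 0) ->
  edge_projection prj ->
  (exists2 p, square p & X p != 0) ->
  discontinuity_region X = @Sigma R ->
  (H.[0, 0] = 0 ->
   map_poly (horner_eval 0) H - map_poly (horner_eval 1) H != 0 ->
   (forall x0 G, bb_cycle H x0 G ->
      G `<=` [set p | heval H p = heval H (x0, 0)] ->
      positive_min (fun p => enorm (grad H p)) G) ->
   (forall x0 G, bb_cycle H x0 G ->
      G `<=` [set p | heval H p = heval H (x0, 0)] ->
      dot (X (x0, 0)) (0, 1) != 0 /\ dot (X (x0, 1)) (0, -1) != 0) ->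
   ([set G | limit_cycle H G /\ exists x0, bb_cycle H x0 G] #<= `I_(n - 1))%card)
  /\
  (H.[0, 0] = 0 ->
   H.[0%:P] - H.[1%:P] != 0 ->
   (forall y0 G, aa_cycle H y0 G ->
      G `<=` [set p | heval H p = heval H (0, y0)] ->
      positive_min (fun p => enorm (grad H p)) G) ->
   (forall y0 G, aa_cycle H y0 G ->
      G `<=` [set p | heval H p = heval H (0, y0)] ->
      dot (X (0, y0)) (1, 0) != 0 /\ dot (X (1, y0)) (-1, 0) != 0) ->
   ([set G | limit_cycle H G /\ exists y0, aa_cycle H y0 G] #<= `I_(n - 1))%card).
Proof.
move=> n1 _ prjP _ _.
split=> _ P0 _ tr.
- apply: (@card_joining_cycles R H prj (fun x => (x, 0)) (fun x => (x, 1)) (0, 1)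
    (map_poly (horner_eval 0) H - map_poly (horner_eval 1) H)) => //.
  + by move=> r /andP[_ r2]; rewrite /dot /= mulr0 mulr1 add0r.
  + by move=> x; rewrite /dot /= mulr0 mul0r addr0.
  + by move=> x; rewrite /dot /= mulr0 mulr1 add0r.
  + by move=> x /andP[/ltW x0 /ltW x1]; rewrite /square /= x0 x1 lexx ler01.
  (* As 0 < x < 1, the first coordinate is identified with nothing else; only the second may switch
     between 0 and 1. *)
  + move=> x [r1 r2] x01 [] [/= h1 h2]; rewrite (circle_eq_inner h1 x01);
      by case: h2 => [->|[-> _]|[-> _]]; tauto.
  + exact: size_edge_difference_x.
  + move=> x; rewrite hornerD hornerN.
    (* The two orders of evaluation agree: y in the coefficients and then x, or the constant
       polynomial x and then y. *)
    have E (y : R) : (map_poly (horner_eval y) H).[x] = H.[x, y].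
      by have := horner_map (horner_eval y) H x%:P; rewrite /= /horner_eval hornerC.
    by rewrite !E.
  + by move=> x G x01 jG /(tr x G (conj x01 jG))[].
  + by move=> G [_ [x [x01 jG]]]; exists x.
- apply: (@card_joining_cycles R H prj (fun y => (0, y)) (fun y => (1, y)) (1, 0)
    (H.[0%:P] - H.[1%:P])) => //.
  + by move=> r /andP[r1 _]; rewrite /dot /= mulr0 mulr1 addr0.
  + by move=> x; rewrite /dot /= mulr0 mul0r addr0.
  + by move=> x; rewrite /dot /= mulr0 mulr1 addr0.
  + by move=> x /andP[/ltW x0 /ltW x1]; rewrite /square /= x0 x1 lexx ler01.
  + move=> y [r1 r2] y01 [] [/= h1 h2]; rewrite (circle_eq_inner h2 y01);
      by case: h1 => [->|[-> _]|[-> _]]; tauto.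
  + exact: size_edge_difference_y.
  + by move=> y; rewrite hornerD hornerN.
  + by move=> y G y01 jG /(tr y G (conj y01 jG))[].
  + by move=> G [_ [y [y01 jG]]]; exists y.
Qed.
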